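(* Let $G$ be a finite Abelian group. Then for every complex Banach space $X$ the Fourier transform $\mathcal{F}: L_2(G,X)\to L_2(\widehat G,X)$ is bounded.
   Context: $\widehat G$ is the Pontryagin dual (character group) of $G$ and $\langle \xi,t\rangle$ is the canonical pairing of $\xi\in\widehat G$ and $t\in G$. Haar measure on $G$ (and on $\widehat G\cong G$) is normalized to be self-dual, i.e. $\mu_G(G)=\sqrt{|G|}$, so each point has mass $1/\sqrt{|G|}$. $L_2(G,X)$ is the space of all functions $\varphi:G\to X$ with norm $\|\varphi\|=(\int_G\|\varphi(t)\|_X^2\,d\mu_G(t))^{1/2}$, and similarly for $L_2(\widehat G,X)$. The Fourier transform is $(\mathcal F\varphi)(\xi)=\frac{1}{\sqrt{|G|}}\sum_{t\in G}\langle\xi,t\rangle\varphi(t)$. *)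

(* Defs.v *)
(* The complex numbers are R[i], for R : realType. *)
From HB Require Import structures.
From mathcomp Require Import all_boot all_order all_fingroup all_algebra.
From mathcomp Require Import cyclic complex.
From mathcomp Require Import all_classical all_reals all_analysis.
Import Order.TTheory GRing.Theory Num.Theory.
Import numFieldNormedType.Exports.

Set Implicit Arguments.
Unset Strict Implicit.
Unset Printing Implicit Defensive.

Local Open Scope ring_scope.

Section PontryaginDual.
Variables (R : realType) (G : finZmodType).

(* G is discrete, so characters need no continuity condition. *)
Definition is_character (f : {ffun G -> R[i]}) : bool :=
  [forall s, forall t, f (s + t) == f s * f t] && [forall t, `|f t| == 1].

Record dual : predArgType :=
  Dual { dual_fun : {ffun G -> R[i]}; dualP : is_character dual_fun }.

HB.instance Definition _ := [isSub for dual_fun].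
HB.instance Definition _ := [Choice of dual by <:].

Definition pairing (xi : dual) (t : G) : R[i] := dual_fun xi t.

Lemma pairingD xi s t : pairing xi (s + t) = pairing xi s * pairing xi t.
Proof. by have /andP[/forallP/(_ s)/forallP/(_ t)/eqP] := dualP xi. Qed.

Lemma norm_pairing xi t : `|pairing xi t| = 1.
Proof. by have /andP[_ /forallP/(_ t)/eqP] := dualP xi. Qed.

Lemma pairing_neq0 xi t : pairing xi t != 0.
Proof. by rewrite -normr_eq0 norm_pairing oner_eq0. Qed.

Lemma pairing0 xi : pairing xi 0 = 1.
Proof.
by apply: (mulfI (pairing_neq0 xi 0)); rewrite -pairingD addr0 mulr1.
Qed.

Lemma pairingMn xi t n : pairing xi (t *+ n) = pairing xi t ^+ n.
Proof.
by elim: n => [|n IHn]; rewrite ?mulr0n ?pairing0 // mulrS exprS pairingD IHn.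
Qed.

Lemma pairing_unity xi t : pairing xi t ^+ #|G| = 1.
Proof.
rewrite -pairingMn -FinRing.zmodXgE -cardsT.
by rewrite (@expg_cardG _ [set: G]%G t (finset.in_setT _)) FinRing.zmod1gE pairing0.
Qed.

Lemma dual_ext xi eta : pairing xi =1 pairing eta -> xi = eta.
Proof. by move=> e; apply/val_inj/ffunP => t; exact: e. Qed.

Fact is_character1 : is_character [ffun => 1].
Proof.
apply/andP; split; apply/forallP => s; last by rewrite ffunE normr1.
by apply/forallP => t; rewrite !ffunE mulr1.
Qed.

Fact is_characterV xi : is_character [ffun t => (pairing xi t)^-1].
Proof.
apply/andP; split; apply/forallP => s.
  by apply/forallP => t; rewrite !ffunE pairingD invfM.
by rewrite ffunE normfV norm_pairing invr1.
Qed.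

Fact is_characterM xi eta :
  is_character [ffun t => pairing xi t * pairing eta t].
Proof.
apply/andP; split; apply/forallP => s.
  by apply/forallP => t; rewrite !ffunE !pairingD mulrACA.
by rewrite ffunE normrM !norm_pairing mulr1.
Qed.

(* The group law, pointwise multiplication, is written additively. *)
Definition dual_zero : dual := Dual is_character1.
Definition dual_opp (xi : dual) : dual := Dual (is_characterV xi).
Definition dual_add (xi eta : dual) : dual := Dual (is_characterM xi eta).

Lemma pairing_dual_add xi eta t :
  pairing (dual_add xi eta) t = pairing xi t * pairing eta t.
Proof. by rewrite {1}/pairing /= ffunE. Qed.

Lemma pairing_dual_zero t : pairing dual_zero t = 1.
Proof. by rewrite /pairing /= ffunE. Qed.

Lemma pairing_dual_opp xi t : pairing (dual_opp xi) t = (pairing xi t)^-1.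
Proof. by rewrite {1}/pairing /= ffunE. Qed.

Let dualE := (pairing_dual_add, pairing_dual_zero, pairing_dual_opp).

Fact dual_addA : associative dual_add.
Proof. by move=> x y z; apply: dual_ext => t; rewrite !dualE mulrA. Qed.

Fact dual_addC : commutative dual_add.
Proof. by move=> x y; apply: dual_ext => t; rewrite !dualE mulrC. Qed.

Fact dual_add0 : left_id dual_zero dual_add.
Proof. by move=> x; apply: dual_ext => t; rewrite !dualE mul1r. Qed.

Fact dual_addN : left_inverse dual_zero dual_opp dual_add.
Proof.
by move=> x; apply: dual_ext => t; rewrite !dualE mulVf ?pairing_neq0.
Qed.

HB.instance Definition _ :=
  GRing.isZmodule.Build dual dual_addA dual_addC dual_add0 dual_addN.

(* Character values are roots of 'X^#|G| - 1, whence finiteness of the dual. *)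
Definition unity_seq : seq R[i] :=
  sval (closed_field_poly_normal ('X^#|G| - 1 : {poly R[i]})).

Fact pairing_unity_seq xi t : pairing xi t \in unity_seq.
Proof.
rewrite /unity_seq; case: closed_field_poly_normal => r /= rE.
have G_gt0 : (0 < #|G|)%N by apply/card_gt0P; exists 0.
have : root ('X^#|G| - 1) (pairing xi t).
  by rewrite rootE !hornerE pairing_unity subrr.
rewrite rE rootZ ?root_prod_XsubC // lead_coef_eq0.
by rewrite -size_poly_eq0 size_Xn_sub_1.
Qed.

Definition dual_code (xi : dual) : {ffun G -> seq_sub unity_seq} :=
  [ffun t => SeqSub (pairing_unity_seq xi t)].

Definition dual_decode (c : {ffun G -> seq_sub unity_seq}) : option dual :=
  insub [ffun t => ssval (c t)].

Fact dual_codeK : pcancel dual_code dual_decode.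
Proof.
move=> xi; rewrite /dual_decode.
have -> : [ffun t => ssval (dual_code xi t)] = val xi.
  by apply/ffunP => t; rewrite !ffunE.
by rewrite valK.
Qed.

HB.instance Definition _ := PCanIsCountable dual_codeK.
HB.instance Definition _ := fintype.isFinite.Build dual (pcan_enumP dual_codeK).

End PontryaginDual.

(* Mass of a point, both in G and in its dual, for the self-dual Haar measures. *)
Definition haar_mass (R : realType) (G : finZmodType) : R :=
  (Num.sqrt (#|G|%:R : R))^-1.

Section L2.
Variables (R : realType) (X : completeNormedModType R[i]).

(* The norm of X takes values in R[i], on the nonnegative real axis. *)
Definition normX (x : X) : R := complex.Re `|x|.

(* L_2(T, X) is {ffun T -> X} normed as follows, where T is a finite set on
   which every point has mass m. *)
Definition L2norm (m : R) (T : finType) (phi : {ffun T -> X}) : R :=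
  Num.sqrt (\sum_(t : T) m * normX (phi t) ^+ 2).

Variable G : finZmodType.

Definition fourier (phi : {ffun G -> X}) : {ffun dual R G -> X} :=
  [ffun xi => ((haar_mass R G)%:C)%C *: \sum_(t : G) pairing xi t *: phi t].

Fact fourier_is_linear : linear fourier.
Proof.
move=> a f g; apply/ffunP => xi; rewrite !ffunE.
rewrite scalerA mulrC -scalerA -scalerDr; congr (_ *: _).
rewrite scaler_sumr -big_split /=; apply: eq_bigr => t _.
by rewrite !ffunE scalerDr !scalerA mulrC.
Qed.

HB.instance Definition _ :=
  GRing.isLinear.Build R[i] {ffun G -> X} {ffun dual R G -> X} _ fourier
    fourier_is_linear.

End L2.

Definition bounded_operator (R : realType) (U V : lmodType R[i])
    (normU : U -> R) (normV : V -> R) (f : {linear U -> V}) : Prop :=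
  exists C : R, forall u : U, normV (f u) <= C * normU u.

(* Main.v *)
(* The operator norm is crudely estimated: every value of phi is controlled by
   the L2 norm of phi because points have positive mass, characters have modulus
   one, and the dual group is finite. *)
Require Import Defs.
From HB Require Import structures.
From mathcomp Require Import all_boot all_order all_fingroup all_algebra.
From mathcomp Require Import complex.
From mathcomp Require Import all_classical all_reals all_analysis.
Import numFieldNormedType.Exports.
Local Open Scope ring_scope.

Import Order.TTheory GRing.Theory Num.Theory.

Set Implicit Arguments.
Unset Strict Implicit.
Unset Printing Implicit Defensive.

(** A nonnegative element of [R[i]] is real, so taking [complex.Re] loses nothing; this carries
    inequalities between [R[i]]-valued norms over to [R]. *)
Lemma normXE (R : realType) (X : completeNormedModType R[i]) (x : X) :
  `|x| = ((normX x)%:C)%C.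
Proof. by rewrite RRe_real ?ger0_real. Qed.

Lemma normX_ge0 (R : realType) (X : completeNormedModType R[i]) (x : X) :
  0 <= normX x.
Proof. by have := normr_ge0 x; rewrite lecE => /andP[]. Qed.

Lemma normX_sum (R : realType) (X : completeNormedModType R[i]) (I : finType)
    (f : I -> X) :
  normX (\sum_i f i) <= \sum_i normX (f i).
Proof.
rewrite -lecR -normXE (le_trans (ler_norm_sum _ _ _)) //.
by rewrite rmorph_sum /=; apply: ler_sum => i _; rewrite normXE.
Qed.

Lemma normXZ (R : realType) (X : completeNormedModType R[i]) (a : R[i]) (x : X) :
  normX (a *: x) = complex.Re `|a| * normX x.
Proof. by rewrite {1}/normX normrZ normXE; case: `|a| => b c /=; rewrite mulr0 subr0.
Qed.

Lemma haar_mass_gt0 (R : realType) (G : finZmodType) : 0 < haar_mass R G.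
Proof. by rewrite invr_gt0 sqrtr_gt0 ltr0n; apply/card_gt0P; exists 0. Qed.

Lemma normX_le_L2norm (R : realType) (X : completeNormedModType R[i]) (m : R)
    (T : finType) (phi : {ffun T -> X}) (t : T) :
  0 < m -> normX (phi t) <= (Num.sqrt m)^-1 * L2norm m phi.
Proof.
move=> m_gt0; rewrite mulrC ler_pdivlMr ?sqrtr_gt0 //.
(* With [normX (phi t)] written as the root of its square, both sides are single square roots, and
   it remains to bound one term by a sum of nonnegative terms. *)
rewrite -{1}(ger0_norm (normX_ge0 (phi t))) -sqrtr_sqr -sqrtrM ?sqr_ge0 //.
rewrite ler_wsqrtr // mulrC (bigD1 t) //= lerDl sumr_ge0 // => i _.
by rewrite mulr_ge0 ?sqr_ge0 ?ltW.
Qed.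

(** Compare with the constant function [B]: [m *+ #|T|] is the total mass of [T]. *)
Lemma L2norm_le_bound (R : realType) (X : completeNormedModType R[i]) (m B : R)
    (T : finType) (phi : {ffun T -> X}) :
  0 <= m -> 0 <= B -> (forall t, normX (phi t) <= B) ->
  L2norm m phi <= Num.sqrt (m *+ #|T|) * B.
Proof.
move=> m_ge0 B_ge0 phiB.
rewrite -{1}(ger0_norm B_ge0) -sqrtr_sqr -sqrtrM ?mulrn_wge0 // ler_wsqrtr //.
rewrite mulrnAl -sumr_const; apply: ler_sum => t _.
by rewrite ler_wpM2l // lerXn2r ?nnegrE ?normX_ge0.
Qed.

Lemma normX_fourier_le (R : realType) (X : completeNormedModType R[i])
    (G : finZmodType) (phi : {ffun G -> X}) (xi : dual R G) :
  normX (fourier phi xi) <= haar_mass R G * \sum_t normX (phi t).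
Proof.
have m_ge0 := ltW (haar_mass_gt0 R G).
rewrite ffunE normXZ ger0_norm ?lecR //= ler_wpM2l //.
rewrite (le_trans (normX_sum _)) //; apply: ler_sum => t _.
by rewrite normXZ norm_pairing mul1r.
Qed.

Theorem theorem3 (R : realType) (G : finZmodType)
    (X : completeNormedModType R[i]) :
  bounded_operator
    (@L2norm R X (haar_mass R G) G)
    (@L2norm R X (haar_mass R G) (dual R G))
    (@fourier R X G).
Proof.
have m_gt0 := haar_mass_gt0 R G; set m := haar_mass R G in m_gt0 *.
(* Read from the right: each of the [#|G|] values of [phi] costs a factor [(Num.sqrt m)^-1], the
   Fourier normalization contributes [m], and the root of the total mass of the dual turns the
   uniform bound into an L2 bound. *)
exists (Num.sqrt (m *+ #|dual R G|) * (m * ((Num.sqrt m)^-1 *+ #|G|))) => phi.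
rewrite -mulrA; apply: L2norm_le_bound => [||xi]; first exact: ltW.
  by rewrite !mulr_ge0 ?mulrn_wge0 ?invr_ge0 ?sqrtr_ge0 // ltW.
rewrite (le_trans (normX_fourier_le _ _)) // -mulrA ler_pM2l //.
by rewrite mulrnAl -sumr_const; apply: ler_sum => t _; exact: normX_le_L2norm.
Qed.
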